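(* Let $\mathcal{A} \subseteq \mathcal{F}$ be a field of subsets of $\mathbb{N}$ and $p \in [1,\infty)$. Then the following statements hold. 1. $K_p(\mathcal{A})$ is a vector subspace of $L_p(\mathcal{A})$. 2. For all $h \in K_p(\mathcal{A})$, $\nu_N(\lvert h \rvert^p)$ converges to $\int \lvert h \rvert^p d\nu$ and $\nu_N(h)$ converges to $\int h \, d\nu$ as $N \rightarrow \infty$. 3. The function $\| \cdot \|_{K_p(\mathcal{A})} : K_p(\mathcal{A}) \rightarrow \mathbb{R}$ given by $\| h \|_{K_p(\mathcal{A})} := \left( \nu(\lvert h \rvert^p) \right)^{1/p}$ is a pseudonorm on $K_p(\mathcal{A})$. 4. For all $h \in K_p(\mathcal{A})$, $\| h \|_{K_p(\mathcal{A})} = \left( \int \lvert h \rvert^p d\nu \right)^{1/p} = \| h \|_{L_p(\mathcal{A})}$. That is, the embedding of $K_p(\mathcal{A})$ in $L_p(\mathcal{A})$ is an isometry. 5. For $h_1, h_2 \in K_p(\mathcal{A})$, $\| h_1 - h_2 \|_{K_p(\mathcal{A})} = 0$ if and only if $h_1$ and $h_2$ are equal a.e. 6. The quotient space $\mathcal{K}_p(\mathcal{A})$ is a vector space with norm $\| [h] \|_{K_p(\mathcal{A})} := \| h \|_{K_p(\mathcal{A})}$.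
   Context: $\mathbb{N} = \{1,2,3,\ldots\}$. For $f:\mathbb{N}\to\mathbb{R}$, $\nu_N(f) := \frac{1}{N}\sum_{n=1}^N f(n)$, $\nu^+(f) := \limsup_{N\to\infty}\nu_N(f)$, and $\nu(f) := \lim_{N\to\infty}\nu_N(f)$ when the limit exists. For $A\subseteq\mathbb{N}$ write $\nu_N(A) := \nu_N(I_A)$ and $\nu(A) := \nu(I_A)$ with $I_A$ the indicator function. $\mathcal{F}$ is the collection of all $A\subseteq\mathbb{N}$ for which $\nu(A)$ exists. On a field of sets $\mathcal{A}\subseteq\mathcal{F}$ (closed under complements and finite unions), $\nu$ is finitely additive. Peano–Jordan completion: $\overline{\mathcal{A}} := \{A\subseteq\mathbb{N} : \forall\epsilon>0\ \exists B,C\in\mathcal{A}$ with $B\subseteq A\subseteq C$ and $\nu(C\setminus B)<\epsilon\}$. Outer charge: $\nu^*(A) := \inf\{\nu(B) : B\in\mathcal{A}, A\subseteq B\}$ for $A\subseteq\mathbb{N}$. A function $f:\mathbb{N}\to\mathbb{R}$ is null (w.r.t. $\mathcal{A}$) if $\nu^*(\{|f|>\epsilon\})=0$ for all $\epsilon>0$; $f=g$ a.e. means $f-g$ is null. A simple function is a finite sum $\sum_k c_k I_{A_k}$ with $c_k\in\mathbb{R}$ and $\{A_k\}\subseteq\mathcal{A}$ a finite partition of $\mathbb{N}$; its integral is $\sum_k c_k\nu(A_k)$. $f_n\to f$ hazily if $\nu^*(\{|f_n-f|>\epsilon\})\to 0$ for every $\epsilon>0$. $f$ is $T_1$-measurable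 if it is a hazy limit of simple functions. $f$ is integrable if there are simple functions $f_n\to f$ hazily with $\int|f_n-f_m|\,d\nu\to 0$ as $n,m\to\infty$; then $\int f\,d\nu := \lim_n\int f_n\,d\nu$. $L_p(\mathcal{A})$ is the set of $T_1$-measurable $f:\mathbb{N}\to\mathbb{R}$ with $|f|^p$ integrable, with pseudonorm $\|f\|_{L_p(\mathcal{A})} = (\int|f|^p d\nu)^{1/p}$. $K_p(\mathcal{A})$ is the set of all $h:\mathbb{N}\to\mathbb{R}$ such that (i) there is a countable $C\subset\mathbb{R}$ with $h^{-1}(y,\infty)\in\overline{\mathcal{A}}$ for all $y\in\mathbb{R}\setminus C$; and (ii) for all $\epsilon>0$ there is $y\in(0,\infty)$ with $\nu^+(g I_{g^{-1}(y^p,\infty)})<\epsilon$, where $g:=|h|^p$. $\mathcal{K}_p(\mathcal{A})$ is the set of equivalence classes $[h]$ of $K_p(\mathcal{A})$ under equality a.e. *)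

(* Defs.v *)
From HB Require Import structures.
From mathcomp Require Import all_boot all_order all_algebra.
From mathcomp Require Import all_classical all_reals all_analysis.
Set Implicit Arguments.
Unset Strict Implicit.
Unset Printing Implicit Defensive.
Import Order.TTheory GRing.Theory Num.Theory.
Import numFieldNormedType.Exports.
Local Open Scope classical_set_scope.
Local Open Scope ring_scope.

Definition Npos : Type := {n : nat | (0 < n)%N}.

Definition mkNpos (n : nat) : Npos := exist _ n.+1 (ltn0Sn n).

Definition set_field (T : Type) (A : set (set T)) : Prop :=
  [/\ A set0, setC_closed A & setU_closed A].

Section density.
Context {R : realType}.
Implicit Types f g : Npos -> R.

(* [mkNpos n] is n + 1, so the sum runs over f 1, ..., f N; the value at
   N = 0 is junk and irrelevant for the limits. *)
Definition nu_ (N : nat) f : R := N%:R^-1 * \sum_(n < N) f (mkNpos n).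

Definition nu f : R := limn (nu_ ^~ f).

(* Extended-real valued: the upper limit may be +oo or -oo. *)
Definition nu_sup f : \bar R := limn_esup (fun N => (nu_ N f)%:E).

Definition nu_set (S : set Npos) : R := nu \1_S.

End density.

(* The sets that have a density. *)
Definition dens_sets (R : realType) : set (set Npos) :=
  [set S | cvgn (fun N => nu_ N (\1_S : Npos -> R))].

Definition PJ_completion (R : realType) (A : set (set Npos)) : set (set Npos) :=
  [set S | forall eps : R, 0 < eps ->
     exists B C, [/\ A B, A C, B `<=` S, S `<=` C & nu_set (C `\` B) < eps]].

Section charge_integration.
Context {R : realType}.
Variable A : set (set Npos).
Implicit Types f g h : Npos -> R.

Definition nu_outer (S : set Npos) : R :=
  inf [set nu_set B | B in [set B | A B /\ S `<=` B]].

Definition null_fun f : Prop :=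
  forall eps : R, 0 < eps -> nu_outer [set n | eps < `|f n|] = 0.

Definition eq_ae f g : Prop := null_fun (f - g).

Definition simple_decomp f (m : nat) (c : 'I_m -> R) (S : 'I_m -> set Npos) :
    Prop :=
  [/\ forall k, A (S k),
      partition [set: 'I_m] S [set: Npos] &
      f = (fun n => \sum_(k < m) c k * \1_(S k) n)].

Definition simple f : Prop := exists m c S, @simple_decomp f m c S.

(* The value does not depend on the decomposition when A is a field of sets
   with densities; [xget] selects it. *)
Definition simple_integral f : R :=
  xget 0 [set v | exists m c S,
    @simple_decomp f m c S /\ v = \sum_(k < m) c k * nu_set (S k)].

Definition hazy_cvg (f_ : nat -> Npos -> R) f : Prop :=
  forall eps : R, 0 < eps ->
    nu_outer [set x | eps < `|f_ n x - f x|] @[n --> \oo] --> (0 : R).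

Definition T1_measurable f : Prop :=
  exists f_ : nat -> Npos -> R, (forall n, simple (f_ n)) /\ hazy_cvg f_ f.

Definition determining_seq (f_ : nat -> Npos -> R) f : Prop :=
  [/\ forall n, simple (f_ n),
      hazy_cvg f_ f &
      simple_integral (fun x => `|f_ nm.1 x - f_ nm.2 x|)
        @[nm --> filter_prod \oo \oo] --> (0 : R)].

Definition charge_integrable f : Prop :=
  exists f_ : nat -> Npos -> R, determining_seq f_ f.

(* The value does not depend on the determining sequence; [xget] selects it,
   and gives 0 when f is not integrable. *)
Definition charge_integral f : R :=
  xget 0 [set v | exists f_ : nat -> Npos -> R, determining_seq f_ f /\
    simple_integral (f_ n) @[n --> \oo] --> v].

Variable p : R.

Definition Lp : set (Npos -> R) :=
  [set f | T1_measurable f /\ charge_integrable (fun n => `|f n| `^ p)].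

Definition Lp_norm f : R := charge_integral (fun n => `|f n| `^ p) `^ p^-1.

Definition Kp : set (Npos -> R) :=
  [set h |
    (exists C : set R, countable C /\
       forall y, ~ C y -> PJ_completion R A [set n | y < h n]) /\
    (let g := fun n => `|h n| `^ p in
     forall eps : R, 0 < eps -> exists2 y : R, 0 < y &
       (nu_sup (fun n => (g n * \1_[set m | y `^ p < g m] n)%R) < eps%:E)%E)].

Definition Kp_norm h : R := nu (fun n => `|h n| `^ p) `^ p^-1.

Definition Kp_class h : set (Npos -> R) := [set g | Kp g /\ eq_ae g h].

Definition Kp_quotient : set (set (Npos -> R)) := [set Kp_class h | h in Kp].

End charge_integration.

Definition vector_subspace (R : pzRingType) (V : lmodType R) (K L : set V) :
    Prop :=
  K `<=` L /\ GRing.submod_closed (fun v => v \in K).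

Definition pseudonorm_on (R : numDomainType) (V : lmodType R) (K : set V)
    (N : V -> R) : Prop :=
  [/\ forall v, K v -> 0 <= N v,
      forall a v, K v -> N (a *: v) = `|a| * N v &
      forall v w, K v -> K w -> N (v + w) <= N v + N w].

(* Main.v *)
From HB Require Import structures.
Require Import Defs.
From mathcomp Require Import all_boot all_order all_algebra.
From mathcomp Require Import all_classical all_reals all_analysis.
From mathcomp Require Import ring lra.
Import Order.TTheory GRing.Theory Num.Theory.
Import numFieldNormedType.Exports.
Local Open Scope classical_set_scope.
Local Open Scope ring_scope.

(** Everything rests on two observations.

    The charge is an honest density, so a simple function [s] has integral
    [lim_N nu_ N s] ([cvg_simple_integral]).  Inequalities between integrals can
    therefore be read off from inequalities between arithmetic means, and
    [mean_le f e], which says that the means of [f] are ultimately at most [e],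
    replaces upper limits throughout.

    Membership in [Kp] is equivalent ([KpE]) to two conditions that are visibly
    stable under the operations needed: [h] is uniformly close to a simple
    function off a set of the field of small charge ([approximable]), and
    [|h|^p] is uniformly integrable with respect to the means ([unif_int]).  From
    level sets to approximation, the levels are chosen in a fine grid avoiding
    the countable exceptional set, and the tails are controlled by uniform
    integrability.  Conversely, if the level set at [y] is not in the
    Peano-Jordan completion, then its inner and outer charges bound a nonempty
    interval; for different levels these intervals are disjoint, so there are
    countably many of them.

    Uniform integrability implies absolute continuity: [|h| 1_E] has small means
    as soon as [E] has small charge ([unif_int_small]).  Hence an approximable
    uniformly integrable [h] has a determining sequence, obtained by putting each
    approximant equal to 0 on its exceptional set, and every determining sequence
    [f_] satisfies [limsup_N nu_ N |h - f_ k| -> 0] ([determining_mean]).  This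
    gives in one stroke the existence of [lim_N nu_ N h], its equality with the
    limit of the integrals of [f_], and so the independence of the integral of
    the sequence ([integral_mean]).  It applies to [h] and, since [x |-> |x|^p] is
    locally Lipschitz, to [|h|^p].

    The triangle inequality is Minkowski's, proved for asymptotic means by
    convexity of the power.  A member of [Kp] has norm 0 exactly when it is null,
    by a Markov inequality in one direction and absolute continuity in the other.
    So the classes modulo equality a.e. are the classes of the pseudonorm, and
    the last item is the general quotient of a pseudonormed space
    ([seminorm_quotient]). *)

Set Implicit Arguments.
Unset Strict Implicit.
Unset Printing Implicit Defensive.

(** * Asymptotic means *)

Section averages.
Context {R : realType}.
Implicit Types (f g : Npos -> R) (N : nat).

Lemma nu_D N f g : nu_ N (fun n => f n + g n) = nu_ N f + nu_ N g.
Proof. by rewrite /nu_ big_split mulrDr. Qed.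

Lemma nu_Z N (c : R) f : nu_ N (fun n => c * f n) = c * nu_ N f.
Proof. by rewrite /nu_ -mulr_sumr mulrCA. Qed.

Lemma nu_B N f g : nu_ N (fun n => f n - g n) = nu_ N f - nu_ N g.
Proof. by rewrite /nu_ sumrB mulrBr. Qed.

Lemma ler_nu N f g : (forall n, f n <= g n) -> nu_ N f <= nu_ N g.
Proof. by move=> fg; rewrite ler_wpM2l ?invr_ge0// ler_sum. Qed.

Lemma nu_ge0 N f : (forall n, 0 <= f n) -> 0 <= nu_ N f.
Proof. by move=> f0; rewrite mulr_ge0 ?invr_ge0// sumr_ge0. Qed.

Lemma nu_cst N (c : R) : nu_ N.+1 (fun=> c) = c.
Proof. by rewrite /nu_ sumr_const card_ord -[c *+ _]mulr_natl mulKf. Qed.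

Lemma ler_norm_nu N f : `|nu_ N f| <= nu_ N (fun n => `|f n|).
Proof.
by rewrite normrM ger0_norm ?invr_ge0// ler_wpM2l ?invr_ge0// ler_norm_sum.
Qed.

(** The usable form of [limsup_N nu_ N f <= e]: as it is stated with real
    numbers, bounds can be added and scaled.  It is slightly stronger than the
    upper limit bound, and equivalent to it once [e] may be enlarged. *)
Definition mean_le f (e : R) : Prop := \forall N \near \oo, nu_ N f <= e.

Lemma mean_leD f g a b : mean_le f a -> mean_le g b ->
  mean_le (fun n => f n + g n) (a + b).
Proof. by apply: filterS2 => N fa gb; rewrite nu_D lerD. Qed.

Lemma mean_leZ c f a : 0 <= c -> mean_le f a ->
  mean_le (fun n => c * f n) (c * a).
Proof. by move=> c0; apply: filterS => N fa; rewrite nu_Z ler_wpM2l. Qed.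

Lemma mean_le_cst c : mean_le (fun=> c) c.
Proof.
(* The mean over no terms is 0, whence the restriction to [N >= 1]. *)
by exists 1%N => // -[]// N _; rewrite nu_cst.
Qed.

Lemma mean_le_trans f g a b :
  (forall n, f n <= g n) -> mean_le g a -> a <= b -> mean_le f b.
Proof.
move=> fg ga ab; apply: filterS ga => N gN.
by rewrite (le_trans (ler_nu N fg))// (le_trans gN).
Qed.

Lemma cvg_mean_le f (l e : R) : nu_ N f @[N --> \oo] --> l -> l < e ->
  mean_le f e.
Proof. by move=> fl le_e; apply: filterS (cvgr_lt _ fl _ le_e) => N /ltW. Qed.

Lemma mean_le_cvg f (l e : R) : nu_ N f @[N --> \oo] --> l -> mean_le f e ->
  l <= e.
Proof. by move=> fl fe; exact: cvgr_to_le fl fe. Qed.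

Lemma nu_sup_lt f (e : R) : (nu_sup f < e%:E)%E -> mean_le f e.
Proof.
move=> /ereal_inf_lt[_ [V Voo <-] Ve]; apply: filterS Voo => N VN.
rewrite -lee_fin (le_trans _ (ltW Ve))//; apply: ereal_sup_ubound.
by exists N.
Qed.

Lemma nu_sup_le f (e : R) : mean_le f e -> (nu_sup f <= e%:E)%E.
Proof.
move=> fe; apply: (@le_trans _ _ (ereal_sup
  ((fun N => (nu_ N f)%:E) @` [set N | nu_ N f <= e]))).
  by apply: ereal_inf_lbound; exists [set N | nu_ N f <= e].
by apply: ge_ereal_sup => _ [N Ne <-]; rewrite lee_fin.
Qed.

End averages.

(** * Charges and simple functions *)

Section field_of_sets.
Context {R : realType}.
Variable A : set (set Npos).
Hypotheses (hA : set_field A) (hAF : A `<=` dens_sets R).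
Implicit Types (S T E : set Npos) (f g h s : Npos -> R).
Local Notation mu := (@nu_set R).

Lemma fieldC S : A S -> A (~` S).
Proof. by case: hA => _ + _; exact. Qed.

Lemma field0 : A set0. Proof. by case: hA. Qed.

Lemma fieldT : A setT.
Proof. by rewrite -setC0; exact/fieldC/field0. Qed.

Lemma fieldU S T : A S -> A T -> A (S `|` T).
Proof. by case: hA => _ _; exact. Qed.

Lemma fieldI S T : A S -> A T -> A (S `&` T).
Proof.
move=> AS AT; rewrite -[S `&` T]setCK setCI.
by apply/fieldC/fieldU; exact: fieldC.
Qed.

Lemma fieldD S T : A S -> A T -> A (S `\` T).
Proof. by move=> AS AT; apply: fieldI => //; exact: fieldC. Qed.

Lemma field_bigcup (I : choiceType) (D : set I) (F : I -> set Npos) :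
  finite_set D -> (forall i, D i -> A (F i)) -> A (\bigcup_(i in D) F i).
Proof.
move=> /finite_seqP[r ->] AF; rewrite bigcup_seq.
elim: r AF => [|i r IHr] AF; first by rewrite big_nil; exact: field0.
rewrite big_cons; apply: fieldU; first by apply: AF; exact: mem_head.
by apply: IHr => j jr; apply: AF; rewrite /= inE jr orbT.
Qed.

Lemma cvg_nu_set S : A S -> nu_ N (\1_S : Npos -> R) @[N --> \oo] --> mu S.
Proof. exact: hAF. Qed.

Lemma indic_le S T n : S `<=` T -> \1_S n <= \1_T n :> R.
Proof.
move=> ST; rewrite !indicE ler_nat.
by case: (boolP (n \in S)) => // /set_mem/ST/mem_set->.
Qed.

Lemma indicT S n : S n -> \1_S n = 1 :> R.
Proof. by move=> Sn; rewrite indicE mem_set. Qed.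

Lemma indicF S n : ~ S n -> \1_S n = 0 :> R.
Proof. by move=> Sn; rewrite indicE memNset. Qed.

Lemma mean_nu_set S e : A S -> mu S < e -> mean_le (\1_S : Npos -> R) e.
Proof. by move=> /cvg_nu_set; exact: cvg_mean_le. Qed.

Lemma nu_set_mean S e : A S -> mean_le (\1_S : Npos -> R) e -> mu S <= e.
Proof. by move=> /cvg_nu_set; exact: mean_le_cvg. Qed.

Lemma nu_set_ge0 S : A S -> 0 <= mu S.
Proof.
move=> /cvg_nu_set Sl; apply: cvgr_to_ge Sl _; apply: nearW => N.
by apply: nu_ge0 => n; rewrite indicE.
Qed.

Lemma nu_setU S T : A S -> A T -> mu (S `|` T) <= mu S + mu T.
Proof.
move=> AS AT; apply: ler_cvg_to (cvg_nu_set (fieldU AS AT))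
  (cvgD (cvg_nu_set AS) (cvg_nu_set AT)) _.
apply: nearW => N; rewrite -[leRHS]nu_D; apply: ler_nu => n.
by rewrite !indicE in_setU -natrD ler_nat; do 2 case: (_ \in _).
Qed.

Lemma nu_set0 : mu set0 = 0.
Proof.
rewrite /nu_set /nu (_ : (fun N => _) = cst 0); first exact: lim_cst.
by apply/funext => N; rewrite /nu_ big1 ?mulr0// => i _; rewrite indicE in_set0.
Qed.

Lemma nu_outer_le S E : A E -> S `<=` E -> nu_outer A S <= mu E.
Proof.
move=> AE SE; apply: ge_inf; last by exists E.
by exists 0 => _ [B [AB _] <-]; exact: nu_set_ge0.
Qed.

Lemma nu_outer_ge0 S : 0 <= nu_outer A S :> R.
Proof.
apply: lb_le_inf; first by exists (mu setT), setT => //; split=> //; exact: fieldT.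
by move=> _ [B [AB _] <-]; exact: nu_set_ge0.
Qed.

Lemma nu_outer_lt S e : nu_outer A S < e ->
  exists E, [/\ A E, S `<=` E & mu E < e].
Proof.
move=> /inf_lt[|_ [E [AE SE] <-] Ee]; last by exists E.
by exists (mu setT), setT => //; split=> //; exact: fieldT.
Qed.

(** The identity behind the choice of densities as charge: the elementary
    integral of a decomposition is the limit of the means, whatever the
    decomposition. *)
Lemma simple_decomp_cvg f m (c : 'I_m -> R) (S : 'I_m -> set Npos) :
   simple_decomp A f c S ->
  nu_ N f @[N --> \oo] --> \sum_(k < m) c k * mu (S k).
Proof.
case=> AS _ ->.
rewrite (_ : (fun N => _) =
    fun N => \sum_(k < m) c k * nu_ N (\1_(S k) : Npos -> R)).
  apply: cvg_big => [|k _]; first exact: add_continuous.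
  by apply: cvgMl_tmp; exact: cvg_nu_set.
apply/funext => N; rewrite /nu_ exchange_big mulr_sumr.
by apply: eq_bigr => k _; rewrite -mulr_sumr mulrCA.
Qed.

Lemma cvg_simple_integral f : simple A f ->
  nu_ N f @[N --> \oo] --> simple_integral A f.
Proof.
move=> [m [c [S fS]]]; rewrite /simple_integral; case: xgetP.
  by move=> _ -> [m' [c' [S' [/simple_decomp_cvg]]]] + ->.
by move=> /(_ (\sum_(k < m) c k * mu (S k)))[]; exists m, c, S.
Qed.

(** Trades explicit partitions for a condition on values and fibers, from which
    closure under pointwise operations is immediate. *)
Lemma simpleP f :
  simple A f <-> finite_set (range f) /\ forall v, A (f @^-1` [set v]).
Proof.
split=> [[m [c [S [AS [cS tS S0] fE]]]]|[/finite_seqP[s fs] Af]].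
  have fS n k : S k n -> f n = c k.
    move=> Skn; rewrite fE (bigD1 k)//= indicE mem_set// mulr1 big1 ?addr0//.
    move=> j jk; rewrite indicE memNset ?mulr0// => Sjn.
    by move/eqP : jk; apply; apply: tS => //; exists n.
  have exS n : exists k, S k n.
    by have : [set: Npos] n by []; rewrite -cS => -[k _ Skn]; exists k.
  split.
    apply: (@sub_finite_set _ _ (c @` [set: 'I_m])); last first.
      exact/finite_image/finite_finset.
    by move=> _ [n _ <-]; have [k /fS->] := exS n; exists k.
  move=> v; rewrite (_ : _ @^-1` _ = \bigcup_(k in [set k | c k = v]) S k).
    by apply: field_bigcup => //; exact: finite_finset.
  apply/seteqP; split=> [n /= fnv|n [k /= <- /fS]//].
  by have [k Skn] := exS n; exists k => //=; rewrite -(fS _ _ Skn).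
(* The values must be listed without repetition for the fibers to be disjoint. *)
pose u := undup s; pose c (k : 'I_(size u)) := u`_k.
have cu k : c k \in u by exact: mem_nth.
have fu n : f n \in u by rewrite mem_undup; have : range f (f n) by []; rewrite fs.
pose kf n : 'I_(size u) := Ordinal (etrans (index_mem _ _) (fu n)).
have ckf n : c (kf n) = f n by exact: nth_index.
have cI k l : c k = c l -> k = l.
  by move=> /eqP; rewrite nth_uniq ?undup_uniq// => /eqP/val_inj.
exists (size u), c, (fun k => f @^-1` [set c k]); split => //.
  split.
  - by apply/seteqP; split=> // n _; exists (kf n) => //=; rewrite ckf.
  - by move=> k l _ _ [n /= [->]]; exact: cI.
  - move=> k _; have := cu k; rewrite mem_undup => ks.
    by have : [set` s] (c k) by []; rewrite -fs => -[n _ fn]; exists n.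
apply/funext => n; rewrite (bigD1 (kf n))//= indicE mem_set//= ckf mulr1.
rewrite big1 ?addr0// => k kn; rewrite indicE memNset ?mulr0//=.
by rewrite -ckf => /cI kE; rewrite kE eqxx in kn.
Qed.

Lemma simple_map (phi : R -> R) f : simple A f ->
  simple A (fun n => phi (f n)).
Proof.
move=> /simpleP[ff Af]; apply/simpleP; split.
  by have := finite_image phi ff; rewrite image_comp.
move=> v; rewrite (_ : _ @^-1` _ =
    \bigcup_(a in [set a | range f a /\ phi a = v]) f @^-1` [set a]).
  by apply: field_bigcup => //; apply: sub_finite_set ff => a [].
apply/seteqP; split=> [n /= fn|n [a [_ <-] /= ->]//].
by exists (f n) => //; split=> //; exists n.
Qed.

Lemma simple_map2 (phi : R -> R -> R) f g : simple A f -> simple A g ->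
  simple A (fun n => phi (f n) (g n)).
Proof.
move=> /simpleP[ff Af] /simpleP[fg Ag]; apply/simpleP; split.
  apply: sub_finite_set (finite_image2 phi ff fg) => _ [n _ <-].
  by exists (f n) => //; exists (g n).
move=> v; rewrite (_ : _ @^-1` _ =
    \bigcup_(ab in [set ab | (range f `*` range g) ab /\ phi ab.1 ab.2 = v])
      (f @^-1` [set ab.1] `&` g @^-1` [set ab.2])).
  apply: field_bigcup => // [|ab _]; last exact/fieldI.
  by apply: sub_finite_set (finite_setX ff fg) => ab [].
apply/seteqP; split=> [n /= fn|n [ab [_ <-] /= [-> ->]]//].
by exists (f n, g n) => //=; split=> //; split; exists n.
Qed.

Lemma simple_cst (c : R) : simple A (fun=> c).
Proof.
apply/simpleP; split; first exact: finite_image_cst.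
move=> v; have [->|cv] := eqVneq c v.
  by rewrite (_ : _ @^-1` _ = setT) //; [exact: fieldT|exact/seteqP].
rewrite (_ : _ @^-1` _ = set0); first exact: field0.
by apply/seteqP; split => // n /= /eqP; rewrite (negbTE cv).
Qed.

Lemma simple_indic S : A S -> simple A (\1_S : Npos -> R).
Proof.
move=> AS; apply/simpleP; split.
  apply: (@sub_finite_set _ _ [set 0; 1]); last exact: finite_set2.
  by move=> _ [n _ <-]; rewrite indicE; case: (_ \in _) => /=; [right|left].
move=> v; have [->|v1] := eqVneq v 1.
  rewrite (_ : _ @^-1` _ = S)//; apply/seteqP; split=> n /=; rewrite indicE.
    by case: (boolP (n \in S)) => [/set_mem//|_ /eqP]; rewrite eq_sym oner_eq0.
  by move=> Sn; rewrite mem_set.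
have [->|v0] := eqVneq v 0.
  rewrite (_ : _ @^-1` _ = ~` S); first exact: fieldC.
  apply/seteqP; split=> n /=; rewrite indicE.
    case: (boolP (n \in S)) => [_ /eqP|/negP nS _ Sn]; first by rewrite oner_eq0.
    by apply: nS; exact: mem_set.
  by move=> Sn; rewrite memNset.
rewrite (_ : _ @^-1` _ = set0); first exact: field0.
apply/seteqP; split=> // n /=; rewrite indicE.
by case: (_ \in _) => /eqP; rewrite eq_sym ?(negbTE v1) ?(negbTE v0).
Qed.

Lemma simple_bounded f : simple A f -> exists2 M, 0 <= M & forall n, `|f n| <= M.
Proof.
move=> /simpleP[/finite_seqP[s fs] _]; exists (\sum_(v <- s) `|v|).
  exact: sumr_ge0.
move=> n; have : range f (f n) by []; rewrite fs /= => fns.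
by rewrite (big_rem _ fns)/= lerDl sumr_ge0.
Qed.

End field_of_sets.

(** * Integration of uniformly integrable functions *)

Section integration.
Context {R : realType}.
Variable A : set (set Npos).
Hypotheses (hA : set_field A) (hAF : A `<=` dens_sets R).
Implicit Types (S T E : set Npos) (f g h s : Npos -> R).
Local Notation mu := (@nu_set R).

(** Equivalent to T1-measurability, in a form with one approximant at a time and
    an exceptional set belonging to the field. *)
Definition approximable h : Prop := forall e : R, 0 < e -> exists s E,
  [/\ simple A s, A E, mu E < e & forall n, ~ E n -> `|h n - s n| <= e].

Definition unif_int g : Prop := forall e : R, 0 < e -> exists2 y : R, 0 < y &
  mean_le (fun n => `|g n| * \1_[set m | y < `|g m|] n) e.

(** Domination by the maximum rather than by the sum: when [|f|] exceeds
    [c * max y1 y2], the larger of [|g1|] and [|g2|] exceeds its own threshold, so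
    the tail of [f] is covered by the two tails. *)
Lemma unif_int_dom c f g1 g2 : 0 < c ->
  (forall n, `|f n| <= c * Num.max `|g1 n| `|g2 n|) ->
  unif_int g1 -> unif_int g2 -> unif_int f.
Proof.
move=> c0 fg ug1 ug2 e e0.
have e'0 : 0 < e / (c * 2) by rewrite divr_gt0// mulr_gt0.
have [y1 y10 gy1] := ug1 _ e'0; have [y2 y20 gy2] := ug2 _ e'0.
exists (c * Num.max y1 y2); first by rewrite mulr_gt0// lt_max y10.
apply: mean_le_trans (mean_leZ (ltW c0) (mean_leD gy1 gy2)) _ => [n|]; last first.
  by rewrite le_eqVlt; apply/orP; left; apply/eqP; field; rewrite gt_eqF.
rewrite [X in X <= _]/= [\1_[set m | _ < `|f m|] n]indicE.
case: (boolP (n \in _)); last first.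
  move=> _; rewrite mulr0; apply: mulr_ge0; first exact: ltW.
  by apply: addr_ge0; rewrite mulr_ge0// indicE.
rewrite inE/= mulr1 => yf; have := lt_le_trans yf (fg n).
rewrite ltr_pM2l// gt_max !lt_max => /andP[y1g y2g].
apply: (le_trans (fg n)); rewrite ler_pM2l//.
have [g12|g12] := leP `|g1 n| `|g2 n|.
  have y2g' : y2 < `|g2 n| by case/orP: y2g => // /lt_le_trans; apply.
  by rewrite (@indicT _ [set m | y2 < `|g2 m|])// mulr1 lerDr mulr_ge0// indicE.
have y1g' : y1 < `|g1 n| by case/orP: y1g => // /lt_trans; apply.
by rewrite (@indicT _ [set m | y1 < `|g1 m|])// mulr1 lerDl mulr_ge0// indicE.
Qed.

Lemma unif_int_cst c : unif_int (fun=> c).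
Proof.
move=> e e0; exists (`|c| + 1); first by rewrite ltr_wpDl.
apply: mean_le_trans (mean_le_cst 0) (ltW e0) => n.
by rewrite indicE memNset ?mulr0//= => /lt_geF; rewrite lerDl ler01.
Qed.

Lemma unif_int_bounded M f : (forall n, `|f n| <= M) -> unif_int f.
Proof.
move=> fM; apply: (unif_int_dom ltr01 _ (@unif_int_cst M) (@unif_int_cst M)) => n.
by rewrite maxxx mul1r (le_trans (fM n))// ler_norm.
Qed.

(** Absolute continuity of the mean with respect to the charge: split [|h|] at
    the height [y] of a small tail; the bounded part contributes [y * mu E]. *)
Lemma unif_int_small h e : unif_int h -> 0 < e -> exists2 d : R, 0 < d &
  forall E, A E -> mu E < d -> mean_le (fun n => `|h n| * \1_E n) e.
Proof.
move=> uh e0; have [y y0 hy] := uh _ (divr_gt0 e0 (ltr0n R 2)).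
exists (e / 2 / y) => [|E AE Ed]; first by rewrite !divr_gt0.
apply: mean_le_trans (mean_leD hy (mean_leZ (ltW y0) (mean_nu_set hAF AE Ed))) _.
  move=> n; rewrite !indicE; case: (boolP (n \in E)) => _; last first.
    by rewrite mulr0 mulr0 addr0 mulr_ge0.
  rewrite !mulr1; case: (boolP (_ \in _)) => [_|].
    by rewrite mulr1 lerDl ltW.
  by rewrite notin_setE/= mulr0 add0r => /negP; rewrite -leNgt.
by rewrite mulrCA mulfV ?gt_eqF// mulr1 -splitr.
Qed.

(** The approximant is set to 0 on its exceptional set [E], so that the error on
    [E] is [|h|] itself, which absolute continuity controls. *)
Lemma approximable_mean h e : approximable h -> unif_int h -> 0 < e ->
  exists s E, [/\ simple A s, A E, mu E < e,
    forall n, ~ E n -> `|s n - h n| <= e & mean_le (fun n => `|s n - h n|) e].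
Proof.
move=> ah uh e0; have e20 : 0 < e / 2 by rewrite divr_gt0.
have [d d0 hd] := unif_int_small uh e20.
have e'0 : 0 < Num.min (e / 2) d by rewrite lt_min e20.
have [s [E [ss AE]]] := ah _ e'0; rewrite lt_min => /andP[Ee Ed] sE.
have {}sE n : ~ E n -> `|h n - s n| <= e / 2.
  by move=> /sE; rewrite le_min => /andP[].
exists (fun n => s n * \1_(~` E) n), E; split => //.
- by apply: simple_map2 => //; apply: simple_indic => //; exact: fieldC.
- by rewrite (lt_le_trans Ee)// ler_piMr ?ltW// invf_lt1 ?ltr1n.
- move=> n En; rewrite indicE mem_set// mulr1 distrC (le_trans (sE _ En))//.
  by rewrite ler_piMr ?ltW// invf_lt1 ?ltr1n.
apply: mean_le_trans (mean_leD (mean_le_cst (e / 2)) (hd E AE Ed)) _.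
  move=> n; rewrite !indicE in_setC; case: (boolP (n \in E)) => nE.
    by rewrite mulr0 mulr1 add0r normrN lerDr ltW.
  by rewrite mulr0 mulr1 addr0 distrC sE//; rewrite notin_setE in nE.
by rewrite -splitr.
Qed.

Lemma approximable_integrable h : approximable h -> unif_int h ->
  charge_integrable A h.
Proof.
move=> ah uh.
have e_gt0 (k : nat) : 0 < k.+1%:R^-1 :> R by rewrite invr_gt0.
have /choice[f_ /choice[E_ fE]] := fun k => approximable_mean ah uh (e_gt0 k).
exists f_; split.
- by move=> n; case: (fE n).
- move=> eps eps0; apply/cvgrPdist_lt => e e0.
  near=> n; rewrite sub0r normrN ger0_norm ?nu_outer_ge0//.
  have [_ AE Ee Es _] := fE n.
  apply: le_lt_trans (lt_trans Ee _); last first.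
    by near: n; exact: near_infty_natSinv_lt (PosNum e0).
  apply: nu_outer_le => // x /= /lt_geF epsx; apply: contrapT => /Es.
  have : n.+1%:R^-1 < eps.
    by near: n; exact: near_infty_natSinv_lt (PosNum eps0).
  by move=> /ltW /[swap] /le_trans/[apply]; rewrite epsx.
- apply/cvgrPdist_le => e e0; have e20 : 0 < e / 2 by rewrite divr_gt0.
  near=> nm; set g := fun x => _; have sg : simple A g.
    apply: (simple_map2 hA (fun a b => `|a - b|)); first by case: (fE nm.1).
    by case: (fE nm.2).
  have cg := cvg_simple_integral hAF sg.
  rewrite sub0r normrN ger0_norm; last first.
    apply: cvgr_to_ge cg _; apply: nearW => N; apply: nu_ge0 => x.
    exact: normr_ge0.
  apply: mean_le_cvg cg _; have [_ _ _ _ m1] := fE nm.1; have [_ _ _ _ m2] := fE nm.2.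
  apply: mean_le_trans (mean_leD m1 m2) _ => [x|].
    by rewrite (le_trans _ (ler_normB _ _))// opprB addrA subrK.
  rewrite (splitr e) lerD// ltW//; near: nm.
  + exists ([set k | k.+1%:R^-1 < e / 2], setT) => [|[k l] []//].
    by split; [exact: near_infty_natSinv_lt (PosNum e20)|exact: filterT].
  + exists (setT, [set k | k.+1%:R^-1 < e / 2]) => [|[k l] []//].
    by split; [exact: filterT|exact: near_infty_natSinv_lt (PosNum e20)].
Unshelve. all: by end_near. Qed.

(** Hazy convergence bounds [|h - f_ k|] off a small set [E].  On [E] one compares
    [f_ k] with a fixed late term [f_ m]: their difference is small in mean, and
    [|h| + |f_ m|] is uniformly integrable because [f_ m] is bounded. *)
Lemma determining_mean (f_ : nat -> Npos -> R) h e :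
  unif_int h -> determining_seq A f_ h -> 0 < e ->
  \forall k \near \oo, mean_le (fun n => `|h n - f_ k n|) e.
Proof.
move=> uh [sf hf cf] e0; have e40 : 0 < e / 4 by rewrite divr_gt0.
have /cvgrPdist_lt/(_ _ e40)[[P Q] /= [[N1 _ P1] [N2 _ Q1]] PQ] := cf.
have fm k : (N1 <= k)%N -> mean_le (fun n => `|f_ k n - f_ N2 n|) (e / 4).
  move=> N1k; apply: cvg_mean_le (cvg_simple_integral hAF _) _.
    exact: (simple_map2 hA (fun a b => `|a - b|)).
  have := PQ (k, N2); rewrite /= sub0r normrN => /(_ _)/ltr_normlW; apply.
  by split; [exact: P1|apply: Q1 => /=].
have [M M0 fM] := simple_bounded hA (sf N2).
have uG : unif_int (fun n => `|h n| + `|f_ N2 n|).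
  apply: (@unif_int_dom 2 _ h (f_ N2)) => //; last exact: unif_int_bounded fM.
  move=> n; rewrite ger0_norm ?addr_ge0// mulr_natl mulr2n.
  by rewrite lerD// le_max lexx ?orbT.
have [d d0 hd] := unif_int_small uG e40.
apply: filterS2 (cvgr_lt _ (hf _ e40) _ d0) (nbhs_infty_ge N1) => k + N1k.
move=> /nu_outer_lt-/(_ hA)[E [AE SE Ed]].
apply: mean_le_trans
  (mean_leD (mean_leD (mean_le_cst (e / 4)) (hd E AE Ed)) (fm k N1k)) _.
  move=> n; have /ger0_norm-> : 0 <= `|h n| + `|f_ N2 n| by rewrite addr_ge0.
  rewrite indicE; case: (boolP (n \in E)) => nE.
    have -> : h n - f_ k n = - (f_ k n - f_ N2 n) + (h n - f_ N2 n) by ring.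
    rewrite (le_trans (ler_normD _ _))// normrN mulr1 [leRHS]addrC lerD2l.
    by rewrite (le_trans (ler_normB _ _))// lerDr ltW.
  rewrite mulr0 addr0 distrC -[leLHS]addr0 lerD// leNgt; apply/negP => /SE.
  by rewrite notin_setE in nE.
by lra.
Qed.

(** The means of [h] are ultimately close to the integral of [f_ k] for large
    [k], which makes them a Cauchy sequence and forces the common limit. *)
Lemma determining_lim (f_ : nat -> Npos -> R) h :
  unif_int h -> determining_seq A f_ h ->
  exists2 l : R, nu_ N h @[N --> \oo] --> l &
    simple_integral A (f_ k) @[k --> \oo] --> l.
Proof.
move=> uh df; have [sf _ _] := df.
have close e : 0 < e -> \forall k \near \oo, \forall N \near \oo,
    `|nu_ N h - simple_integral A (f_ k)| <= e.
  move=> e0; have e20 : 0 < e / 2 by rewrite divr_gt0.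
  apply: filterS (determining_mean uh df e20) => k.
  have /cvgrPdist_le/(_ _ e20) := cvg_simple_integral hAF (sf k).
  apply: filterS2 => N; rewrite distrC => f1 f2.
  rewrite -(subrK (nu_ N (f_ k)) (nu_ N h)) -addrA (splitr e).
  rewrite (le_trans (ler_normD _ _))// lerD// -nu_B.
  exact: le_trans (ler_norm_nu _ _) f2.
have /cvg_ex[l hl] : cvg (nu_ N h @[N --> \oo]).
  apply/cauchy_cvgP/cauchy_exP => e e0.
  have [k _ /(_ k (leqnn _))] := close _ (divr_gt0 e0 (ltr0n R 2)).
  move=> kh; exists (simple_integral A (f_ k)); apply: filterS kh => N.
  rewrite /ball/= distrC => /le_lt_trans; apply.
  by rewrite ltr_pdivrMr// ltr_pMr// ltr1n.
exists l => //; apply/cvgrPdist_le => e e0.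
apply: filterS (close _ e0) => k hk.
have : `|nu_ N h - simple_integral A (f_ k)| @[N --> \oo] -->
   `|l - simple_integral A (f_ k)|.
  by apply: cvg_norm; apply: cvgB => //; exact: cvg_cst.
by move=> /cvgr_to_le; apply.
Qed.

(** Every determining sequence of [h] leads to the limit of the means, so the
    selected value of the integral is that limit. *)
Lemma integral_mean h : approximable h -> unif_int h ->
  charge_integrable A h /\ nu_ N h @[N --> \oo] --> charge_integral A h.
Proof.
move=> ah uh; have ih := approximable_integrable ah uh; split => //.
have [f_ df] := ih; have [l hl fl] := determining_lim uh df.
rewrite /charge_integral; case: xgetP => [_ -> [g_ [dg gl]]|/(_ l)[]]; last first.
  by exists f_.
have [l' hl' gl'] := determining_lim uh dg.
by rewrite (cvg_unique _ gl gl').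
Qed.

End integration.

(** * Level sets and approximation *)

Section Kp_characterisation.
Context {R : realType}.
Variable A : set (set Npos).
Hypotheses (hA : set_field A) (hAF : A `<=` dens_sets R).
Implicit Types (S T E : set Npos) (f g h s : Npos -> R).
Local Notation mu := (@nu_set R).

Lemma approximable_simple s : simple A s -> approximable A s.
Proof.
move=> ss e e0; exists s, set0; split=> //; first exact: field0.
  by rewrite nu_set0.
by move=> n _; rewrite subrr normr0 ltW.
Qed.

Lemma approximable_lin a f g : approximable A f -> approximable A g ->
  approximable A (fun n => a * f n + g n).
Proof.
move=> af ag e e0; have a0 : 0 < `|a| + 1 by rewrite ltr_wpDl.
pose d := e / (`|a| + 1) / 2; have d0 : 0 < d by rewrite !divr_gt0.
have ade : (`|a| + 1) * d = e / 2 by rewrite /d; field; rewrite gt_eqF.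
have de : d <= e / 2 by rewrite -ade ler_peMl ?lerDr// ltW.
have [s [E [ss AE Ee sE]]] := af _ d0; have [t [F [st AF Fe tF]]] := ag _ d0.
exists (fun n => a * s n + t n), (E `|` F); split.
- exact: (simple_map2 hA (fun x y => a * x + y)).
- exact: fieldU.
- rewrite (le_lt_trans (nu_setU hA hAF AE AF))// (splitr e).
  by rewrite ltrD// (lt_le_trans _ de).
move=> n /not_orP[En Fn].
have -> : a * f n + g n - (a * s n + t n) = a * (f n - s n) + (g n - t n) by ring.
rewrite (le_trans (ler_normD _ _))// normrM.
rewrite (le_trans (lerD (ler_wpM2l (normr_ge0 a) (sE n En)) (tF n Fn)))//.
by rewrite -[X in _ + X]mul1r -mulrDl ade ler_piMr ?ltW// invf_lt1 ?ltr1n.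
Qed.

Lemma approximable_tight h e : approximable A h -> 0 < e -> exists (M : R) E,
  [/\ 0 < M, A E, mu E < e & forall n, ~ E n -> `|h n| <= M].
Proof.
move=> ah e0; have [s [E [ss AE Ee sE]]] := ah _ e0.
have [M M0 sM] := simple_bounded hA ss.
exists (M + e), E; split=> // [|n /sE hs]; first by rewrite ltr_wpDl.
by rewrite -(subrK (s n) (h n)) (le_trans (ler_normD _ _))// addrC lerD.
Qed.

Definition locally_lipschitz (phi : R -> R) := forall M : R, 0 < M ->
  exists2 L : R, 0 < L & forall x y, `|x| <= M -> `|y| <= M ->
    `|phi x - phi y| <= L * `|x - y|.

(** A local Lipschitz bound suffices, since an approximable function is bounded
    off a small set: the approximation is refined after the bound is known. *)
Lemma approximable_comp (phi : R -> R) h : locally_lipschitz phi ->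
  approximable A h -> approximable A (fun n => phi (h n)).
Proof.
move=> lphi ah e e0; have e20 : 0 < e / 2 by rewrite divr_gt0.
have [M [E [M0 AE Ee hM]]] := approximable_tight ah e20.
have [L L0 phiL] := lphi _ (addr_gt0 M0 ltr01).
have d0 : 0 < Num.min (Num.min (e / 2) 1) (e / L).
  by rewrite !lt_min e20 ltr01 divr_gt0.
have [s [F [ss AF + sF]]] := ah _ d0; rewrite !lt_min -andbA => /and3P[Fe _ _].
exists (fun n => phi (s n)), (E `|` F); split.
- exact: (simple_map hA).
- exact: fieldU.
- by rewrite (le_lt_trans (nu_setU hA hAF AE AF))// (splitr e) ltrD.
move=> n /not_orP[En /sF]; rewrite !le_min -andbA => /and3P[_ hs1 hsL].
rewrite (le_trans (phiL _ _ _ _))//.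
- by rewrite (le_trans (hM _ En))// lerDl.
- rewrite -(subrK (h n) (s n)) (le_trans (ler_normD _ _))// addrC lerD//.
    exact: hM.
  by rewrite distrC.
- by rewrite mulrC -ler_pdivlMr.
Qed.

(** Markov inequality at a threshold at least 1. *)
Lemma unif_int_tail g e : unif_int g -> 0 < e ->
  exists2 y : R, 0 < y & mean_le (\1_[set n | y < `|g n|] : Npos -> R) e.
Proof.
move=> ug e0; have [y y0 gy] := ug _ e0.
exists (Num.max y 1); first by rewrite lt_max y0.
apply: mean_le_trans gy (lexx e) => n.
have [|gn] := pselect ([set m | Num.max y 1 < `|g m|] n); last first.
  by rewrite (indicF gn) mulr_ge0// indicE.
move=> gn; rewrite (indicT gn); move: gn; rewrite /= gt_max => /andP[yg g1].
by rewrite (@indicT _ [set m | y < `|g m|])// mulr1 ltW.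
Qed.

(** An interval of positive length is not contained in a Lebesgue null set. *)
Lemma dodge_countable (C : set R) (x y : R) : countable C -> x < y ->
  exists z, [/\ x < z, z < y & ~ C z].
Proof.
move=> cC xy; apply: contrapT => nz.
have sub : [set` `]x, y[] `<=` C.
  move=> z /=; rewrite in_itv/= => /andP[xz zy]; apply: contrapT => Cz.
  by apply: nz; exists z.
have := countable_lebesgue_measure0 (sub_countable (subset_card_le sub) cC).
rewrite lebesgue_measure_itv/= lte_fin xy -EFinB => -[] /eqP.
by rewrite subr_eq0 gt_eqF.
Qed.

(** Induction on the number of cells.  The new approximant equals [a k] on the
    inner approximation [B] of [[set n | a k < h n]]; outside the thin set
    [C `\` B], not being in [B] means being below [a k], where the previous
    approximant applies.  The grid need not be increasing. *)
Lemma grid_approximation h (a : nat -> R) (e : R) (k : nat) :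
  (forall j, PJ_completion R A [set n | a j < h n]) ->
  (forall j, a j.+1 <= a j + e) -> 0 <= e ->
  forall d, 0 < d -> exists s E, [/\ simple A s, A E, mu E < d &
    forall n, ~ E n -> a 0%N < h n -> h n <= a k -> `|h n - s n| <= e].
Proof.
move=> hPJ ha e0; elim: k => [|k IHk] d d0.
  exists (fun=> 0), set0; split; [exact: simple_cst|exact: field0| |].
    by rewrite nu_set0.
  by move=> n _ /lt_le_trans/[apply]; rewrite ltxx.
have d20 : 0 < d / 2 by rewrite divr_gt0.
have [s [E [ss AE Ed sE]]] := IHk _ d20.
have [B [C [AB AC Bh hC CBd]]] := hPJ k _ d20.
exists (fun n => s n + \1_B n * (a k - s n)), (E `|` (C `\` B)); split.
- apply: (simple_map2 hA (fun x y => x + y * (a k - x))) => //.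
  exact: simple_indic.
- by apply: fieldU => //; exact: fieldD.
- rewrite (le_lt_trans (nu_setU hA hAF AE (fieldD hA AC AB)))//.
  by rewrite (splitr d) ltrD.
move=> n /not_orP[En CBn] ah hk.
have [Bn|Bn] := pselect (B n).
  rewrite (indicT Bn) mul1r [X in _ - X]addrC subrK; have := Bh _ Bn => /= akh.
  rewrite ger0_norm; last by rewrite subr_ge0 ltW.
  by rewrite lerBlDl (le_trans hk).
rewrite (indicF Bn) mul0r addr0; apply: sE => //.
by rewrite leNgt; apply/negP => /hC Cn; apply: CBn; split.
Qed.

(** The grid covers [[-M, M]] with steps at most [e]; the set [far] of the points
    that its approximating sets show to lie outside the grid is charged by the
    tail [M < |h|] only. *)
Lemma PJ_approximable h (C : set R) : countable C ->
  (forall y, ~ C y -> PJ_completion R A [set n | y < h n]) ->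
  (forall e : R, 0 < e ->
     exists2 M : R, 0 < M & mean_le (\1_[set n | M < `|h n|] : Npos -> R) e) ->
  approximable A h.
Proof.
move=> cC hPJ hM e e0; have e20 : 0 < e / 2 by rewrite divr_gt0.
have e50 : 0 < e / 5 by rewrite divr_gt0.
have [M M0 tM] := hM _ e50.
pose x j := - M - e / 2 + j%:R * (e / 2).
(* The point [a j] is sought in the [j]-th interval of length [e / 2], so that
   two successive points differ by less than [e]. *)
have /choice[a ax] : forall j, exists z, [/\ x j < z, z < x j + e / 2 & ~ C z].
  by move=> j; apply: dodge_countable => //; rewrite ltrDl.
have a0 : a 0%N < - M by have [_ + _] := ax 0%N; rewrite /x mul0r addr0 subrK.
have [k ak] : exists k, M < a k.
  have [k kM] : exists k : nat, (M + M + e / 2) / (e / 2) < k%:R.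
    exists (Num.bound ((M + M + e / 2) / (e / 2))).
    exact/archi_boundP/ltW/divr_gt0/e20/addr_gt0/e20/addr_gt0.
  exists k; have [+ _ _] := ax k; apply: lt_trans; rewrite /x.
  by move: kM; rewrite ltr_pdivrMr//; lra.
have aS j : a j.+1 <= a j + e.
  have [aj _ _] := ax j; have [_ aj1 _] := ax j.+1.
  move: aj aj1; rewrite /x -(natr1 j) mulrDl mul1r; lra.
have aPJ j : PJ_completion R A [set n | a j < h n].
  by apply: hPJ; have [] := ax j.
have [s [E [ss AE Ee sE]]] := grid_approximation k aPJ aS (ltW e0) e50.
have [B0 [C0 [AB0 AC0 B0h hC0 CB0]]] := aPJ 0%N _ e50.
have [Bk [Ck [ABk ACk Bkh hCk CBk]]] := aPJ k _ e50.
pose far := ~` C0 `|` Bk.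
have Afar : A far by apply: fieldU => //; exact: fieldC.
have far_e : mu far <= e / 5.
  apply: (nu_set_mean hAF Afar); apply: mean_le_trans tM (lexx _) => n.
  apply: indic_le => m [C0m|/Bkh/= akh].
    have : h m <= a 0%N by rewrite leNgt; apply/negP => /hC0.
    move=> /le_lt_trans/(_ a0) hm /=; rewrite ltr_normr; apply/orP; right.
    by rewrite ltrNr.
  by rewrite /= ltr_normr (lt_trans ak akh).
exists s, (E `|` (far `|` ((C0 `\` B0) `|` (Ck `\` Bk)))); split => //.
- apply: fieldU => //; apply: fieldU => //; apply: fieldU => //; exact: fieldD.
- have A0 := fieldD hA AC0 AB0; have Ak := fieldD hA ACk ABk.
  have u1 := nu_setU hA hAF A0 Ak.
  have u2 := nu_setU hA hAF Afar (fieldU hA A0 Ak).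
  have u3 := nu_setU hA hAF AE (fieldU hA Afar (fieldU hA A0 Ak)).
  lra.
move=> n /not_orP[En /not_orP[/not_orP[C0n Bkn] /not_orP[CB0n CBkn]]].
apply: sE => //.
  have C0n' : C0 n by apply: contrapT.
  by apply: B0h; apply: contrapT => B0n; apply: CB0n.
by rewrite leNgt; apply/negP => /hCk Ckn; apply: CBkn.
Qed.

(** Inclusion-exclusion for two sets that cover everything; it yields both the
    charge of a complement and that of a difference of nested sets. *)
Lemma nu_set_cover S T : A S -> A T -> S `|` T = setT ->
  mu (S `&` T) = mu S + mu T - 1.
Proof.
move=> AS AT ST; have AI := fieldI hA AS AT.
have cST : nu_ N (\1_S : Npos -> R) + nu_ N (\1_T : Npos -> R) - 1
    @[N --> \oo] --> mu S + mu T - 1.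
  apply: cvgB; last exact: cvg_cst.
  exact: (cvgD (cvg_nu_set hAF AS) (cvg_nu_set hAF AT)).
suff cI : nu_ N (\1_(S `&` T) : Npos -> R) @[N --> \oo] --> mu S + mu T - 1.
  exact: (cvg_unique _ (cvg_nu_set hAF AI) cI).
apply: cvg_trans cST; apply: near_eq_cvg; exists 1%N => // -[]// N _ /=.
rewrite -[X in _ - X](nu_cst N (1 : R)) -nu_D -nu_B.
congr nu_; apply/funext => n; rewrite !indicE in_setI.
have : (n \in S) || (n \in T) by rewrite -in_setU ST inE.
by case: (_ \in _); case: (_ \in _) => // _; rewrite /= ?mulr1n ?mulr0n; ring.
Qed.

Lemma nu_setC S : A S -> mu (~` S) = 1 - mu S.
Proof.
move=> AS; have := nu_set_cover AS (fieldC hA AS) (setUv S).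
by rewrite setICr nu_set0//; lra.
Qed.

(** Here [1 - nu_outer A (~` S)] is the inner charge of [S], so the hypothesis says
    that the inner and the outer charge of [S] agree. *)
Lemma PJ_outer S : nu_outer A S + nu_outer A (~` S) <= 1 :> R ->
  PJ_completion R A S.
Proof.
move=> S1 e e0; have e20 : 0 < e / 2 by rewrite divr_gt0.
have [C [AC SC Ce]] : exists E, [/\ A E, S `<=` E & mu E < nu_outer A S + e / 2].
  by apply: nu_outer_lt => //; rewrite ltrDl.
have [D [AD SD De]] :
    exists E, [/\ A E, ~` S `<=` E & mu E < nu_outer A (~` S) + e / 2].
  by apply: nu_outer_lt => //; rewrite ltrDl.
exists (~` D), C; split => //; first exact: fieldC.
  by rewrite -[S]setCK; exact: subsetC.
rewrite setDE setCK nu_set_cover//; first by lra.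
by apply/seteqP; split=> // n _; have [/SC|/SD] := pselect (S n); [left|right].
Qed.

Lemma simple_level s y : simple A s -> A [set n | y < s n].
Proof.
move=> /(simple_map hA (fun x => (y < x)%R%:R))/simpleP-/(_ hA)[_ /(_ 1)].
congr A; apply/seteqP; split=> n /=; last by move=> ->.
by case: ltP => // _ /eqP; rewrite eq_sym oner_eq0.
Qed.

(** The outer charge of the higher level set is at most the inner charge of the
    lower one: up to a small set, a level set of an approximant lies in between. *)
Lemma outer_levels h y y' : approximable A h -> y < y' ->
  nu_outer A [set n | y' < h n] + nu_outer A (~` [set n | y < h n]) <= 1 :> R.
Proof.
move=> ah yy'; apply/ler_addgt0Pr => e e0.
have d0 : 0 < Num.min (e / 2) ((y' - y) / 2).
  by rewrite lt_min !divr_gt0// subr_gt0.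
have [s [E [ss AE]]] := ah _ d0; rewrite lt_min => /andP[Ee _] sE.
pose d := (y' - y) / 2; pose T := [set n | y + d < s n].
have {}sE n : ~ E n -> `|h n - s n| <= d.
  by move=> /sE; rewrite le_min => /andP[].
have AT : A T by exact: simple_level.
have o1 : nu_outer A [set n | y' < h n] <= mu (T `|` E).
  apply: nu_outer_le => //; first exact: fieldU.
  move=> n /= hn; have [|/sE] := pselect (E n); first by right.
  by rewrite ler_distl => /andP[_ hs]; left; rewrite /T/=; move: hs; rewrite /d; lra.
have o2 : nu_outer A (~` [set n | y < h n]) <= mu (~` T `|` E).
  apply: nu_outer_le => //; first by apply: fieldU => //; exact: fieldC.
  move=> n /= /negP; rewrite -leNgt => hn.
  have [|/sE] := pselect (E n); first by right.
  rewrite ler_distl => /andP[hs _]; left; rewrite /T/= => /lt_geF.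
  by move/negP; apply; move: hs; rewrite /d; lra.
have u1 := nu_setU hA hAF AT AE; have u2 := nu_setU hA hAF (fieldC hA AT) AE.
by have := nu_setC AT; lra.
Qed.

(** An exceptional level has its inner charge strictly below its outer charge.
    By [outer_levels] the intervals so obtained are disjoint, ordered oppositely
    to the levels, and a rational number chosen in each of them enumerates the
    levels. *)
Lemma approximable_levels h : approximable A h ->
  countable [set y | ~ PJ_completion R A [set n | y < h n]].
Proof.
move=> ah; pose out y : R := nu_outer A [set n | y < h n].
pose inn y : R := 1 - nu_outer A (~` [set n | y < h n]).
have /choice[q hq] : forall y, exists q : rat,
    ~ PJ_completion R A [set n | y < h n] -> inn y < ratr q < out y.
  move=> y; have [io|io] := ltP (inn y) (out y).
    have [q] := rat_in_itvoo io; rewrite in_itv/= => hq.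
    by exists q.
  by exists 0; case; apply: PJ_outer; rewrite -lerBrDr.
apply/countable_injP; exists (fun y => pickle (q y)).
have mono y y' : y < y' -> ~ PJ_completion R A [set n | y < h n] ->
    ~ PJ_completion R A [set n | y' < h n] -> q y' != q y.
  move=> yy' /hq/andP[iy _] /hq/andP[_ y'o]; apply/eqP => qq.
  have := outer_levels ah yy'; rewrite -lerBrDr leNgt => /negP; apply.
  by rewrite (lt_trans iy)// -qq.
move=> y y' /set_mem/= Cy /set_mem/= Cy' /(pcan_inj pickleK) qq.
have [yy'|yy'|//] := ltgtP y y'.
  by have := mono _ _ yy' Cy Cy'; rewrite qq eqxx.
by have := mono _ _ yy' Cy' Cy; rewrite qq eqxx.
Qed.

Lemma powR_inv_p (p y : R) : 0 < p -> 0 <= y -> (y `^ p^-1) `^ p = y.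
Proof. by move=> p0 y0; rewrite -powRrM mulVf ?gt_eqF// powRr1. Qed.

Lemma ltr_powR (p x y : R) : 0 < p -> 0 <= x -> 0 <= y ->
  (x `^ p < y `^ p) = (x < y).
Proof.
move=> p0 x0 y0; have [xy|yx] := ltP x y.
  by rewrite gt0_ltr_powR// nnegrE.
by apply/negbTE; rewrite -leNgt ge0_ler_powR ?nnegrE// ltW.
Qed.

(** The working description of [Kp]: every later fact about [Kp] goes through
    it. *)
Lemma KpE (p : R) h : 0 < p ->
  Kp A p h <-> approximable A h /\ unif_int (fun n => `|h n| `^ p).
Proof.
move=> p0; split=> [[[C [cC hC]] h2]|[ah uh]].
  have uh : unif_int (fun n => `|h n| `^ p).
    move=> e /h2[y y0 /nu_sup_lt hy]; exists (y `^ p); first exact: powR_gt0.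
    under eq_fun do rewrite ger0_norm ?powR_ge0//.
    by under eq_set do rewrite ger0_norm ?powR_ge0//.
  split=> //; apply: PJ_approximable cC hC _ => e e0.
  have [y y0 hy] := unif_int_tail uh e0.
  exists (y `^ p^-1); first exact: powR_gt0.
  apply: mean_le_trans hy (lexx _) => n; apply: indic_le => m /=.
  rewrite [X in _ -> _ < X]ger0_norm ?powR_ge0// => hm.
  by rewrite -[ltLHS](powR_inv_p p0 (ltW y0)) ltr_powR// powR_ge0.
split.
  exists [set y | ~ PJ_completion R A [set n | y < h n]].
  by split; [exact: approximable_levels|move=> y /contrapT].
move=> g e e0; have [y y0 hy] := uh _ (divr_gt0 e0 (ltr0n R 2)).
exists (y `^ p^-1); first exact: powR_gt0.
rewrite powR_inv_p ?ltW//.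
apply: (@le_lt_trans _ _ (e / 2)%:E); last first.
  by rewrite lte_fin ltr_pdivrMr// ltr_pMr// ltr1n.
apply: nu_sup_le; move: hy.
under eq_fun do rewrite ger0_norm ?powR_ge0//.
by under eq_set do rewrite ger0_norm ?powR_ge0//.
Qed.

End Kp_characterisation.

(** * Powers and Minkowski's inequality *)

Section powers.
Context {R : realType}.
Implicit Types (p x y : R).

Lemma powR_convex p x y t : 1 <= p -> 0 <= x -> 0 <= y -> 0 <= t <= 1 ->
  ((1 - t) * x + t * y) `^ p <= (1 - t) * x `^ p + t * y `^ p.
Proof.
move=> p1 x0 y0 /andP[t0 t1].
rewrite ![(1 - t) * _ + _]addrC.
by apply: (convex_powR p1 (Itv01 t0 t1)); rewrite inE/= in_itv/= ?x0 ?y0.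
Qed.

(** By convexity, with no derivative: for [0 <= a <= b <= M], the slope between
    [a] and [b] is at most the slope between [a] and [2 * M], a point at distance
    at least [M] from [a]. *)
Lemma locally_lipschitz_powR p : 1 <= p ->
  locally_lipschitz (fun x => `|x| `^ p).
Proof.
move=> p1 M M0; exists ((2 * M) `^ p / M).
  by rewrite divr_gt0// powR_gt0// mulr_gt0.
have p0 : 0 <= p by rewrite (le_trans ler01).
suff key a b : 0 <= a -> a <= b -> b <= M ->
    b `^ p - a `^ p <= (2 * M) `^ p / M * (b - a).
  move=> x y xM yM.
  apply: le_trans (_ : (2 * M) `^ p / M * `| `|x| - `|y| | <= _); last first.
    by rewrite ler_wpM2l ?ler_dist_dist// divr_ge0 ?powR_ge0// ltW.
  have [yx|/ltW xy] := leP `|y| `|x|.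
    rewrite ger0_norm; last by rewrite subr_ge0 ge0_ler_powR ?nnegrE.
    by rewrite (@ger0_norm _ (_ - _)) ?subr_ge0//; exact: key.
  rewrite distrC [X in _ * X]distrC.
  rewrite ger0_norm; last by rewrite subr_ge0 ge0_ler_powR ?nnegrE.
  by rewrite (@ger0_norm _ (_ - _)) ?subr_ge0//; exact: key.
move=> a0 ab bM; have MaM : M <= 2 * M - a by lra.
have Ma : 0 < 2 * M - a by exact: lt_le_trans MaM.
pose t := (b - a) / (2 * M - a).
have t0 : 0 <= t by rewrite /t divr_ge0 ?(ltW Ma)// subr_ge0.
have t1 : t <= 1 by rewrite /t ler_pdivrMr// mul1r; lra.
have bE : b = (1 - t) * a + t * (2 * M) by rewrite /t; field; rewrite gt_eqF.
have tM : t <= (b - a) / M.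
  by rewrite /t ler_wpM2l ?subr_ge0// lef_pV2// posrE.
have M20 : 0 <= 2 * M by rewrite mulr_ge0// ltW.
have := powR_convex p1 a0 M20 (introT andP (conj t0 t1)).
rewrite -bE => bp.
have ta : 0 <= t * a `^ p by rewrite mulr_ge0// powR_ge0.
have tMp : t * (2 * M) `^ p <= (b - a) / M * (2 * M) `^ p.
  by rewrite ler_wpM2r// powR_ge0.
have -> : (2 * M) `^ p / M * (b - a) = (b - a) / M * (2 * M) `^ p by ring.
by move: bp; rewrite mulrBl mul1r; lra.
Qed.

(** Write [|f| + |g|] as [a + b] times the convex combination of [|f| / a] and
    [|g| / b] with weights proportional to [a] and [b]; after applying convexity
    of the power, both terms have means ultimately at most their weight. *)
Lemma mean_le_minkowski p (f g : Npos -> R) a b : 1 <= p -> 0 < a -> 0 < b ->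
  mean_le (fun n => `|f n| `^ p) (a `^ p) ->
  mean_le (fun n => `|g n| `^ p) (b `^ p) ->
  mean_le (fun n => `|f n + g n| `^ p) ((a + b) `^ p).
Proof.
move=> p1 a0 b0 mf mg; have p0 : 0 < p by exact: lt_le_trans p1.
have ab0 : 0 < a + b by exact: addr_gt0.
have [t tE] : exists t, t = b / (a + b) := ex_intro _ _ erefl.
have t0 : 0 <= t by rewrite tE divr_ge0// ltW.
have t1 : t <= 1 by rewrite tE ler_pdivrMr// mul1r lerDr ltW.
have ap0 := powR_gt0 p a0; have bp0 := powR_gt0 p b0; have abp0 := powR_gt0 p ab0.
have ca : 0 <= (a + b) `^ p * (1 - t) / a `^ p.
  by rewrite divr_ge0 ?mulr_ge0 ?subr_ge0// ltW.
have cb : 0 <= (a + b) `^ p * t / b `^ p.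
  by rewrite divr_ge0 ?(ltW bp0)// mulr_ge0// ltW.
apply: mean_le_trans (mean_leD (mean_leZ ca mf) (mean_leZ cb mg)) _ => [n|]; last first.
  by rewrite !divfK ?gt_eqF// -mulrDr subrK mulr1.
have fgE : `|f n| + `|g n| = (a + b) * ((1 - t) * (`|f n| / a) + t * (`|g n| / b)).
  have tb : (a + b) * t = b by rewrite tE mulrC divfK// gt_eqF.
  rewrite mulrDr !mulrA mulrBr mulr1 tb addrK.
  by rewrite [a * _ / _]mulrAC [b * _ / _]mulrAC !divff ?gt_eqF// !mul1r.
apply: (@le_trans _ _ ((`|f n| + `|g n|) `^ p)).
  by rewrite ge0_ler_powR ?nnegrE ?addr_ge0 ?ler_normD// ltW.
have fa0 : 0 <= `|f n| / a by rewrite divr_ge0// ltW.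
have gb0 : 0 <= `|g n| / b by rewrite divr_ge0// ltW.
rewrite fgE powRM ?(ltW ab0)//; last first.
  by rewrite addr_ge0// mulr_ge0// subr_ge0.
have := powR_convex p1 fa0 gb0 (introT andP (conj t0 t1)).
rewrite -(ler_pM2l abp0) => /le_trans; apply.
have divp x y : 0 <= x -> 0 < y -> (x / y) `^ p = x `^ p / y `^ p.
  move=> x0 y0; rewrite powRM ?invr_ge0 ?(ltW y0)//.
  by rewrite -[y^-1]powR_inv1 ?(ltW y0)// powRAC powR_inv1// powR_ge0.
rewrite !divp//; move: (_ `^ p) ((`|f n|) `^ p) => r1 r2.
by rewrite le_eqVlt; apply/orP; left; apply/eqP; ring.
Qed.

End powers.

(** * The pseudonormed space Kp *)

Section Kp_theory.
Context {R : realType}.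
Variables (A : set (set Npos)) (p : R).
Hypotheses (hA : set_field A) (hAF : A `<=` dens_sets R) (p1 : 1 <= p).
Implicit Types (f g h : Npos -> R).
Local Notation mu := (@nu_set R).
Local Notation K := (Kp A p).

Let p0 : 0 < p. Proof. exact: lt_le_trans p1. Qed.

Lemma Kp_powR h : K h -> approximable A (fun n => `|h n| `^ p) /\
  unif_int (fun n => `|h n| `^ p).
Proof.
move=> /(KpE hA hAF h p0)[ah uh]; split=> //.
exact (approximable_comp hA hAF (locally_lipschitz_powR p1) ah).
Qed.

(** Since [p >= 1], [|h|] is dominated by the maximum of 1 and [|h|^p]. *)
Lemma Kp_unif_int h : K h -> approximable A h /\ unif_int h.
Proof.
move=> /(KpE hA hAF h p0)[ah uh]; split=> //.
apply: (unif_int_dom ltr01 _ (@unif_int_cst R 1) uh) => n.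
rewrite mul1r le_max normr1 (ger0_norm (powR_ge0 _ _)).
have [//|h1] := leP `|h n| 1; rewrite /= -[leLHS]powRr1//.
by rewrite ler_powR// ltW.
Qed.

Lemma Kp0 : K 0.
Proof.
apply/(KpE hA hAF _ p0); split.
  by apply: approximable_simple => //; exact: simple_cst.
exact: (@unif_int_cst R (`|0| `^ p)).
Qed.

Lemma Kp_lin a f g : K f -> K g -> K (a *: f + g).
Proof.
move=> /(KpE hA hAF f p0)[af uf] /(KpE hA hAF g p0)[ag ug].
apply/(KpE hA hAF _ p0); split; first exact: approximable_lin.
have a0 : 0 < `|a| + 1 by rewrite ltr_wpDl.
apply: (@unif_int_dom _ ((`|a| + 1) `^ p) _ _ _ _ _ uf ug) => [|n].
  exact: powR_gt0.
rewrite !(ger0_norm (powR_ge0 _ _)).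
pose m := Num.max `|f n| `|g n|; have m0 : 0 <= m by rewrite le_max normr_ge0.
apply: (@le_trans _ _ (((`|a| + 1) * m) `^ p)).
  rewrite ge0_ler_powR ?nnegrE ?mulr_ge0// ?(ltW p0) ?(ltW a0)//.
  rewrite (le_trans (ler_normD _ _))// normrM mulrDl mul1r lerD//.
    by rewrite ler_wpM2l// /m le_max lexx.
  by rewrite /m le_max lexx orbT.
rewrite powRM// ?(ltW a0)//.
rewrite ler_wpM2l ?powR_ge0// /m.
by have [_|_] := leP `|f n| `|g n|; rewrite le_max lexx ?orbT.
Qed.

Lemma Kp_submod : GRing.submod_closed (fun h : Npos -> R => h \in K).
Proof.
split; first by apply: mem_set; exact: Kp0.
by move=> a f g /set_mem Kf /set_mem Kg; apply: mem_set; exact: Kp_lin.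
Qed.

Lemma KpD f g : K f -> K g -> K (f + g).
Proof. by move=> Kf Kg; rewrite -[f]scale1r; exact: Kp_lin. Qed.

Lemma KpZ a f : K f -> K (a *: f).
Proof. by move=> Kf; have := Kp_lin a Kf Kp0; rewrite addr0. Qed.

Lemma KpB f g : K f -> K g -> K (f - g).
Proof. by move=> Kf Kg; rewrite addrC -scaleN1r; exact: Kp_lin. Qed.

Lemma Kp_sub_Lp : K `<=` Lp A p.
Proof.
move=> h Kh; have [aph uph] := Kp_powR Kh; have [ah uh] := Kp_unif_int Kh.
split; last exact: approximable_integrable.
by have [f_ [sf hf _]] := approximable_integrable hA hAF ah uh; exists f_.
Qed.

Lemma cvg_nu_powR h : K h ->
  nu_ N (fun n => `|h n| `^ p) @[N --> \oo] --> nu (fun n => `|h n| `^ p).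
Proof.
move=> /Kp_powR[aph uph]; have [_ c] := integral_mean hA hAF aph uph.
by apply/cvg_ex; eexists; exact: c.
Qed.

Lemma nu_powR_ge0 h : K h -> 0 <= nu (fun n => `|h n| `^ p).
Proof.
move=> /cvg_nu_powR c; apply: cvgr_to_ge c _; apply: nearW => N.
by apply: nu_ge0 => n; exact: powR_ge0.
Qed.

Lemma Kp_norm_powR h : K h -> Kp_norm p h `^ p = nu (fun n => `|h n| `^ p).
Proof. by move=> /nu_powR_ge0 m0; exact: powR_inv_p. Qed.

Lemma Kp_normZ a h : K h -> Kp_norm p (a *: h) = `|a| * Kp_norm p h.
Proof.
move=> Kh; rewrite /Kp_norm.
have -> : nu (fun n => `|(a *: h) n| `^ p) = `|a| `^ p * nu (fun n => `|h n| `^ p).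
  have c := cvg_nu_powR Kh; apply: cvg_lim => //.
  under eq_fun => N.
    under [X in nu_ _ X]eq_fun => n do rewrite [(a *: h) n]/(a * h n) normrM powRM//.
    rewrite nu_Z; over.
  by apply: cvgMl_tmp.
rewrite powRM ?powR_ge0 ?nu_powR_ge0// -powRrM mulfV ?gt_eqF// powRr1//.
Qed.

(** The means of [|h|^p] converge to the power of the norm of [h] but may exceed
    it; they lie ultimately below [c^p] for each larger [c], whence the slack
    [e / 2]. *)
Lemma Kp_norm_triangle f g : K f -> K g ->
  Kp_norm p (f + g) <= Kp_norm p f + Kp_norm p g.
Proof.
move=> Kf Kg; have Kfg := KpD Kf Kg.
have above h e : K h -> 0 < e ->
    mean_le (fun n => `|h n| `^ p) ((Kp_norm p h + e) `^ p).
  move=> Kh e0; apply: cvg_mean_le (cvg_nu_powR Kh) _.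
  have h0 : 0 <= Kp_norm p h by exact: powR_ge0.
  by rewrite -Kp_norm_powR// ltr_powR ?ltrDl// addr_ge0// ltW.
apply/ler_addgt0Pr => e e0; have e20 : 0 < e / 2 by rewrite divr_gt0.
have pos h : 0 < Kp_norm p h + e / 2 by rewrite ltr_wpDl ?powR_ge0.
have := mean_le_minkowski p1 (pos f) (pos g) (above _ _ Kf e20) (above _ _ Kg e20).
rewrite addrACA -splitr => /(mean_le_cvg (cvg_nu_powR Kfg)).
rewrite -Kp_norm_powR// leNgt ltr_powR ?powR_ge0 -?leNgt//.
by rewrite !addr_ge0 ?powR_ge0// ltW.
Qed.

Lemma Kp_pseudonorm : pseudonorm_on K (Kp_norm p).
Proof.
split; [by move=> h _; exact: powR_ge0|exact: Kp_normZ|exact: Kp_norm_triangle].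
Qed.

(** If the norm vanishes, a level set [T] of an approximant squeezed between
    [e < |h|] and [e / 3 < |h|] has small charge by Markov's inequality.  If [h]
    is null, [|h|^p] is small off a set of arbitrarily small charge, and absolute
    continuity does the rest. *)
Lemma Kp_norm_eq0 h : K h -> Kp_norm p h = 0 <-> Defs.null_fun A h.
Proof.
move=> Kh; have [aph uph] := Kp_powR Kh; have [ah uh] := Kp_unif_int Kh.
have c := cvg_nu_powR Kh; split=> [/powR_eq0_eq0 m0 e e0|nh].
  apply/le_anti/andP; split; last exact: nu_outer_ge0.
  apply/ler_addgt0Pr => d d0; rewrite add0r; have e30 : 0 < e / 3 by rewrite divr_gt0.
  have d'0 : 0 < Num.min (d / 4) (e / 3) by rewrite lt_min !divr_gt0.
  have [s [E [ss AE]]] := ah _ d'0; rewrite lt_min => /andP[Ed _] sE.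
  have {}sE n : ~ E n -> `|h n - s n| <= e / 3.
    by move=> /sE; rewrite le_min => /andP[].
  pose T := [set n | e / 3 * 2 < `|s n|].
  have AT : A T by apply: (simple_level hA _ (simple_map hA Num.norm ss)).
  have ep0 := powR_gt0 p e30.
  have mT : mu T <= d / 4 + d / 2.
    apply: (nu_set_mean hAF AT).
    have hm : mean_le (fun n => `|h n| `^ p) ((e / 3) `^ p * (d / 2)).
      by apply: cvg_mean_le c _; rewrite m0 mulr_gt0// divr_gt0.
    have ei : 0 <= ((e / 3) `^ p)^-1 by rewrite invr_ge0 ltW.
    apply: mean_le_trans
      (mean_leD (mean_nu_set hAF AE Ed) (mean_leZ ei hm)) _ => [n|].
      have hp0 : 0 <= ((e / 3) `^ p)^-1 * `|h n| `^ p by rewrite mulr_ge0// powR_ge0.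
      have [En|En] := pselect (E n).
        by rewrite (indicT En) -[leLHS]addr0 lerD.
      rewrite (indicF En) add0r.
      have [Tn|Tn] := pselect (T n); last by rewrite (indicF Tn).
      rewrite (indicT Tn) mulrC ler_pdivlMr// mul1r.
      rewrite ge0_ler_powR ?nnegrE ?(ltW p0) ?(ltW e30)//.
      have := sE _ En; rewrite distrC; have := ler_normD (s n - h n) (h n).
      by rewrite subrK; move: Tn; rewrite /T/=; lra.
    by rewrite mulKf ?gt_eqF.
  apply: (@le_trans _ _ (mu (T `|` E))).
    apply: nu_outer_le => //; first exact: fieldU.
    move=> n /= hn; have [|/sE hs] := pselect (E n); [by right|left].
    by have := ler_normD (h n - s n) (s n); rewrite subrK /T/=; lra.
  by have := nu_setU hA hAF AT AE; lra.
suff m0 : nu (fun n => `|h n| `^ p) = 0.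
  by rewrite /Kp_norm m0 powR0// invr_neq0// gt_eqF.
apply/le_anti; rewrite nu_powR_ge0// andbT; apply/ler_addgt0Pr => e e0; rewrite add0r.
have e20 : 0 < e / 2 by rewrite divr_gt0.
have [d d0 hd] := unif_int_small hAF uph e20.
have [|E [AE hE Ed]] := @nu_outer_lt _ A hA [set n | (e / 2) `^ p^-1 < `|h n|] d.
  by rewrite nh// powR_gt0.
apply: mean_le_cvg c _.
apply: mean_le_trans (mean_leD (mean_le_cst (e / 2)) (hd E AE Ed)) _ => [n|].
  rewrite (ger0_norm (powR_ge0 _ _)); have [En|En] := pselect (E n).
    by rewrite (indicT En) mulr1 lerDr ltW.
  rewrite (indicF En) mulr0 addr0 -[leRHS](powR_inv_p p0 (ltW e20)).
  rewrite leNgt ltr_powR// ?powR_ge0//; apply/negP => hn.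
  by apply: En; exact: hE.
by rewrite -splitr.
Qed.

Lemma Kp_integral h : K h ->
  [/\ charge_integrable A (fun n => `|h n| `^ p),
      nu_ N (fun n => `|h n| `^ p) @[N --> \oo]
        --> charge_integral A (fun n => `|h n| `^ p),
      charge_integrable A h &
      nu_ N h @[N --> \oo] --> charge_integral A h].
Proof.
move=> Kh; have [aph uph] := Kp_powR Kh; have [ah uh] := Kp_unif_int Kh.
have [ip cp] := integral_mean hA hAF aph uph.
by have [i c] := integral_mean hA hAF ah uh.
Qed.

End Kp_theory.

(** * Quotient of a pseudonormed space *)

Section seminorm_quotient.
Context {R : realType} {V0 : lmodType R}.
Variables (K : set V0) (N : V0 -> R).
Hypotheses (hK : GRing.submod_closed (fun v => v \in K)).
Hypothesis (hN : pseudonorm_on K N).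
Implicit Types v w : V0.

Definition seminorm_class v : set V0 := [set w | K w /\ N (w - v) = 0].

Definition seminorm_quot : Type :=
  {X : set V0 | exists2 v, K v & X = seminorm_class v}.

Implicit Types X Y Z : seminorm_quot.

Let K0 : K 0. Proof. by case: hK => /set_mem. Qed.

Let K_lin a v w : K v -> K w -> K (a *: v + w).
Proof. by case: hK => _ Kl Kv Kw; apply/set_mem/Kl; exact: mem_set. Qed.

Let KZ a v : K v -> K (a *: v).
Proof. by move=> Kv; rewrite -[_ *: _]addr0; exact: K_lin. Qed.

Let KD v w : K v -> K w -> K (v + w).
Proof. by move=> Kv Kw; rewrite -[v]scale1r; exact: K_lin. Qed.

Let KN v : K v -> K (- v).
Proof. by move=> Kv; rewrite -scaleN1r; exact: KZ. Qed.

Let N_ge0 v : K v -> 0 <= N v. Proof. by case: hN => + _ _; exact. Qed.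

Let NZ a v : K v -> N (a *: v) = `|a| * N v.
Proof. by case: hN => _ + _; exact. Qed.

Let ND v w : K v -> K w -> N (v + w) <= N v + N w.
Proof. by case: hN => _ _; exact. Qed.

Let NN v : K v -> N (- v) = N v.
Proof. by move=> Kv; rewrite -scaleN1r NZ// normrN1 mul1r. Qed.

Let N0 : N 0 = 0.
Proof. by rewrite -(scale0r (0 : V0)) NZ// normr0 mul0r. Qed.

Let Nle v w : K v -> K w -> N v <= N w + N (v - w).
Proof.
by move=> Kv Kw; rewrite -{1}(subrK w v) addrC ND//; apply: KD => //; exact: KN.
Qed.

Lemma seminorm_class_eq v w : K v -> K w ->
  seminorm_class v = seminorm_class w <-> N (v - w) = 0.
Proof.
move=> Kv Kw; split=> [vw|Nvw].
  have : seminorm_class v v by split; rewrite ?subrr ?N0.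
  by rewrite vw => -[].
apply/seteqP; split=> u [Ku Nu]; split=> //; apply/le_anti/andP; split.
- rewrite (_ : u - w = (u - v) + (v - w)); last by rewrite addrA subrK.
  by rewrite (le_trans (ND _ _))// ?Nu ?Nvw ?addr0//; apply: KD => //; exact: KN.
- by apply: N_ge0; apply: KD => //; exact: KN.
- rewrite (_ : u - v = (u - w) - (v - w)); last by rewrite opprB addrA subrK.
  have Kuw : K (u - w) by apply: KD => //; exact: KN.
  have Kvw : K (v - w) by apply: KD => //; exact: KN.
  by rewrite (le_trans (ND _ _))//; [exact: KN|rewrite NN// Nu Nvw addr0].
- by apply: N_ge0; apply: KD => //; exact: KN.
Qed.

(** The class map, made total by sending points outside [K] to the class of 0.
    With [quotP], [mkP] and the compatibility lemmas, it reduces every axiom of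
    the quotient to the same axiom in [V0]. *)
Let mk v : seminorm_quot := match pselect (K v) with
  | left Kv => exist _ (seminorm_class v) (ex_intro2 _ _ v Kv erefl)
  | right _ => exist _ (seminorm_class 0) (ex_intro2 _ _ 0 K0 erefl) end.

Let rep X : V0 := projT1 (cid2 (projT2 X)).

Let Krep X : K (rep X). Proof. by rewrite /rep; case: cid2. Qed.

Let val_mk v : K v -> sval (mk v) = seminorm_class v.
Proof. by rewrite /mk; case: pselect. Qed.

Let mkP v w : K v -> K w -> N (v - w) = 0 -> mk v = mk w.
Proof.
move=> Kv Kw Nvw; apply: eq_sig_hprop => [S|]; first exact: Prop_irrelevance.
by rewrite !val_mk//; apply/seminorm_class_eq.
Qed.

Let repK X : mk (rep X) = X.
Proof.
apply: eq_sig_hprop => [S|]; first exact: Prop_irrelevance.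
by rewrite val_mk; [rewrite /rep; case: cid2|exact: Krep].
Qed.

Let mkK v : K v -> N (rep (mk v) - v) = 0.
Proof.
move=> Kv; apply/(seminorm_class_eq (Krep _) Kv).
by rewrite -!val_mk ?repK//; exact: Krep.
Qed.

Let add X Y := mk (rep X + rep Y).
Let opp X := mk (- rep X).
Let scale a X := mk (a *: rep X).
Let norm X := N (rep X).

Let mkD v w : K v -> K w -> add (mk v) (mk w) = mk (v + w).
Proof.
move=> Kv Kw; apply: mkP; [by apply: KD; exact: Krep|exact: KD|].
apply/le_anti/andP; split; last first.
  by apply: N_ge0; apply: KD; [apply: KD; exact: Krep|exact/KN/KD].
rewrite opprD addrACA (le_trans (ND _ _)) ?mkK ?addr0//.
  by apply: KD; [exact: Krep|exact: KN].
by apply: KD; [exact: Krep|exact: KN].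
Qed.

Let mkZ a v : K v -> scale a (mk v) = mk (a *: v).
Proof.
move=> Kv; apply: mkP; [by apply: KZ; exact: Krep|exact: KZ|].
rewrite -scalerBr NZ ?mkK ?mulr0//.
by apply: KD; [exact: Krep|exact: KN].
Qed.

Let mkN v : K v -> opp (mk v) = mk (- v).
Proof.
by move=> Kv; rewrite -[- v]scaleN1r -mkZ// /opp /scale scaleN1r.
Qed.

Let norm_mk v : K v -> norm (mk v) = N v.
Proof.
move=> Kv; have Kr : K (rep (mk v)) by exact: Krep.
apply/le_anti/andP; split.
  by rewrite (le_trans (Nle Kr Kv))// mkK// addr0.
by rewrite (le_trans (Nle Kv Kr))// -opprB NN ?mkK ?addr0//; exact/KD/KN.
Qed.

Let quotP X : exists2 v, K v & X = mk v.
Proof. by exists (rep X); [exact: Krep|rewrite repK]. Qed.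

Let addA : associative add.
Proof.
move=> X Y Z; have [x Kx ->] := quotP X; have [y Ky ->] := quotP Y.
by have [z Kz ->] := quotP Z; rewrite !mkD ?addrA//; exact: KD.
Qed.

Let addC : commutative add.
Proof. by move=> X Y; rewrite /add addrC. Qed.

Let add0 : left_id (mk 0) add.
Proof. by move=> X; have [x Kx ->] := quotP X; rewrite mkD ?add0r. Qed.

Let addN : left_inverse (mk 0) opp add.
Proof.
by move=> X; have [x Kx ->] := quotP X; rewrite mkN ?mkD ?addNr//; exact: KN.
Qed.

Let scaleA a b X : scale a (scale b X) = scale (a * b) X.
Proof. by have [x Kx ->] := quotP X; rewrite !mkZ ?scalerA//; exact: KZ. Qed.

Let scale1 : left_id 1 scale.
Proof. by move=> X; have [x Kx ->] := quotP X; rewrite !mkZ ?scale1r. Qed.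

Let scaleDr : right_distributive scale add.
Proof.
move=> a X Y; have [x Kx ->] := quotP X; have [y Ky ->] := quotP Y.
by rewrite !(mkD, mkZ) ?scalerDr//; first [exact: KZ|exact: KD].
Qed.

Let scaleDl X : {morph scale^~ X : a b / a + b >-> add a b}.
Proof.
move=> a b; have [x Kx ->] := quotP X.
by rewrite !mkZ// mkD ?scalerDl//; exact: KZ.
Qed.

Let normD X Y : norm (add X Y) <= norm X + norm Y.
Proof.
have [x Kx ->] := quotP X; have [y Ky ->] := quotP Y.
by rewrite mkD// !norm_mk ?ND//; exact: KD.
Qed.

Let normZ a X : norm (scale a X) = `|a| * norm X.
Proof.
by have [x Kx ->] := quotP X; rewrite mkZ// !norm_mk ?NZ//; exact: KZ.
Qed.

Let norm_eq0 X : norm X = 0 -> X = mk 0.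
Proof.
have [x Kx ->] := quotP X; rewrite norm_mk// => Nx.
by apply: mkP => //; rewrite subr0.
Qed.

Lemma seminorm_quotient :
  exists (V : normedModType R) (phi : set V0 -> V),
  [/\ set_bij [set seminorm_class v | v in K] [set: V] phi,
      forall v w, K v -> K w -> phi (seminorm_class (v + w)) =
        phi (seminorm_class v) + phi (seminorm_class w),
      forall a v, K v ->
        phi (seminorm_class (a *: v)) = a *: phi (seminorm_class v) &
      forall v, K v -> `|phi (seminorm_class v)| = N v].
Proof.
pose Q : choiceType := HB.pack seminorm_quot (gen_eqMixin seminorm_quot)
  (gen_choiceMixin seminorm_quot).
pose Qz : zmodType := HB.pack seminorm_quot (Choice.on Q)
  (GRing.isZmodule.Build Q addA addC add0 addN).
pose Ql : lmodType R := HB.pack seminorm_quot (GRing.Zmodule.on Qz)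
  (GRing.Zmodule_isLmodule.Build R Qz scaleA scale1 scaleDr scaleDl).
pose Qn : normedModType R := HB.pack seminorm_quot (GRing.Lmodule.on Ql)
  (Lmodule_isNormed.Build R Ql normD normZ norm_eq0).
pose phi S : Qn := mk (xget 0 S).
have phiE v : K v -> phi (seminorm_class v) = mk v.
  move=> Kv; rewrite /phi; have : seminorm_class v v by split; rewrite ?subrr ?N0.
  by move=> /(xgetI 0)[Kx Nx]; exact: mkP.
exists Qn, phi; split.
- split=> // [X Y /set_mem[v Kv <-] /set_mem[w Kw <-]|X _].
    by rewrite !phiE// => /(congr1 sval); rewrite !val_mk.
  have [v Kv ->] := quotP X; exists (seminorm_class v); last exact: phiE.
  by exists v.
- by move=> v w Kv Kw; rewrite !phiE//; [rewrite -mkD|exact: KD].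
- by move=> a v Kv; rewrite !phiE//; [rewrite -mkZ|exact: KZ].
- by move=> v Kv; rewrite phiE//; exact: norm_mk.
Qed.

End seminorm_quotient.

(** * The theorem *)

Theorem theorem7p13 (R : realType) (A : set (set Npos)) (p : R)
    (hA : set_field A) (hAF : A `<=` dens_sets R) (hp : 1 <= p) :
  [/\ vector_subspace (Kp A p) (Lp A p),
      forall h, Kp A p h ->
        [/\ charge_integrable A (fun n => `|h n| `^ p),
            nu_ N (fun n => `|h n| `^ p) @[N --> \oo]
              --> charge_integral A (fun n => `|h n| `^ p),
            charge_integrable A h &
            nu_ N h @[N --> \oo] --> charge_integral A h],
      pseudonorm_on (Kp A p) (Kp_norm p),
      forall h, Kp A p h ->
        Kp_norm p h = charge_integral A (fun n => `|h n| `^ p) `^ p^-1 /\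
        charge_integral A (fun n => `|h n| `^ p) `^ p^-1 = Lp_norm A p h &
      (forall h1 h2, Kp A p h1 -> Kp A p h2 ->
         (Kp_norm p (h1 - h2) = 0 <-> eq_ae A h1 h2)) /\
      (exists (V : normedModType R) (phi : set (Npos -> R) -> V),
        [/\ set_bij (Kp_quotient A p) [set: V] phi,
            forall h1 h2, Kp A p h1 -> Kp A p h2 ->
              phi (Kp_class A p (h1 + h2)) =
                phi (Kp_class A p h1) + phi (Kp_class A p h2),
            forall (a : R) h, Kp A p h ->
              phi (Kp_class A p (a *: h)) = a *: phi (Kp_class A p h) &
            forall h, Kp A p h -> `|phi (Kp_class A p h)| = Kp_norm p h])].
Proof.
have classE h : Kp A p h -> Kp_class A p h = seminorm_class (Kp A p) (Kp_norm p) h.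
  move=> Kh; apply/seteqP; split=> g [Kg gh]; split=> //;
    by apply/(Kp_norm_eq0 hA hAF hp (KpB hA hAF hp Kg Kh)).
split.
- by split; [exact: Kp_sub_Lp|exact: Kp_submod].
- by move=> h; exact: Kp_integral.
- exact: Kp_pseudonorm.
- move=> h Kh; have [_ c _ _] := Kp_integral hA hAF hp Kh; split => //.
  by rewrite /Kp_norm /nu (cvg_lim _ c).
split=> [h1 h2 K1 K2|]; first exact/(Kp_norm_eq0 hA hAF hp (KpB hA hAF hp K1 K2)).
have [V [phi [bij phiD phiZ phiN]]] :=
  seminorm_quotient (Kp_submod hA hAF hp) (Kp_pseudonorm hA hAF hp).
exists V, phi; split.
- rewrite (_ : Kp_quotient A p =
      [set seminorm_class (Kp A p) (Kp_norm p) h | h in Kp A p])//.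
  by apply/seteqP; split=> _ [h Kh <-]; exists h => //; rewrite classE.
- move=> h1 h2 K1 K2; rewrite (classE _ (KpD hA hAF hp K1 K2)).
  by rewrite (classE _ K1) (classE _ K2); exact: phiD.
- move=> a h Kh; rewrite (classE _ (KpZ hA hAF hp a Kh)) (classE _ Kh).
  exact: phiZ.
- by move=> h Kh; rewrite (classE _ Kh) phiN.
Qed.
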